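(* The eigenvalue problem $LY=\lambda Y$ and the boundary value problem (P) (both defined in the context) are equivalent in the following sense: $\lambda$ is an eigenvalue of $LY=\lambda Y$ with eigenvector $Y=(y,\mathbf{y}^1,\mathbf{y}^2)$ if and only if $\lambda$ is an eigenvalue of (P) with eigenfunction $y$, where $\mathbf{y}^1,\mathbf{y}^2$ are given from $y$ as follows. If $\eta>0$: $$\mathbf{y}^1=(\lambda I-[\gamma_i])^{-1}\boldsymbol{\beta}\,\Delta' y\ \text{ if }\lambda\ne\gamma_i\text{ for all }i=1,\dots,N',\qquad \mathbf{y}^1=\frac{-y(0^+)}{\beta_I}\boldsymbol{e}^I\ \text{ if }\lambda=\gamma_I\text{ for some } I\in\{1,\dots,N'\}.$$ If $\kappa>0$: $$\mathbf{y}^2=(\lambda I-[\delta_j])^{-1}\boldsymbol{\alpha}\,\Delta y\ \text{ if }\lambda\ne\delta_j\text{ for all }j=1,\dots,M',\qquad \mathbf{y}^2=\frac{y'(0^-)}{\alpha_J}\boldsymbol{e}^J\ \text{ if }\lambda=\delta_J\text{ for some } J\in\{1,\dots,M'\}.$$ If $\eta=0$: $\mathbf{y}^1=(\lambda I-[c_i])^{-1}\mathbf{b}\,y(0^+)$ if $\lambda\neq c_i$ for all $i$, and $\mathbf{y}^1=\frac{\Delta' y}{b_I}\boldsymbol{e}^I$ if $\lambda=c_I$. If $\kappa=0$: $\mathbf{y}^2=(\lambda I-[d_j])^{-1}\mathbf{a}\,y'(0^-)$ if $\lambda\ne d_j$ for all $j$, and $\mathbf{y}^2=\frac{-\Delta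 y}{a_J}\boldsymbol{e}^J$ if $\lambda=d_J$. Here $\boldsymbol{e}^I$ (resp. $\boldsymbol{e}^J$) is the vector with all entries $0$ except the $I$-th (resp. $J$-th), which is $1$. The geometric multiplicity of $\lambda$ as an eigenvalue of $L$ is the same as the geometric multiplicity of $\lambda$ as an eigenvalue of (P).
   Context: Let $a,b>0$, $q\in L^2(-a,b)$, $\alpha\in[0,\pi)$, $\beta\in(0,\pi]$, and $\ell y:=-y''+qy$. Let $N,M\in\mathbb{N}_0$ (empty sums are $0$), $\eta,\kappa\ge 0$, $\xi,\zeta\in\mathbb{R}$, real numbers $c_1<\dots<c_N$ and $d_1<\dots<d_M$, and $b_i>0$ ($i=1,\dots,N$), $a_j>0$ ($j=1,\dots,M$). Put $$\mu(\lambda)=-\Big(\lambda\eta-\xi-\sum_{i=1}^N\frac{b_i^2}{\lambda-c_i}\Big),\qquad \nu(\lambda)=\lambda\kappa+\zeta-\sum_{j=1}^M\frac{a_j^2}{\lambda-d_j}.$$ If $\eta>0$ write $\frac1{\mu(\lambda)}=\sigma-\sum_{i=1}^{N'}\frac{\beta_i^2}{\lambda-\gamma_i}$ with $N'\in\mathbb{N}$, $\gamma_1<\dots<\gamma_{N'}$, $\beta_i>0$; if $\kappa>0$ write $\frac1{\nu(\lambda)}=\tau+\sum_{j=1}^{M'}\frac{\alpha_j^2}{\lambda-\delta_j}$ with $M'\in\mathbb{N}$, $\delta_1<\dots<\delta_{M'}$, $\alpha_j>0$ (such partial fraction expansions exist). Bold letters denote vectors: $\boldsymbol\beta=(\beta_i)$,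 $\boldsymbol\alpha=(\alpha_j)$, $\mathbf b=(b_i)$, $\mathbf a=(a_j)$; $[\gamma_i],[\delta_j],[c_i],[d_j]$ denote the corresponding diagonal matrices. For a function $y$ on $(-a,0)\cup(0,b)$ write $y(0^\pm),y'(0^\pm)$ for one-sided limits at $0$, $\Delta y=y(0^+)-y(0^-)$, $\Delta' y=y'(0^+)-y'(0^-)$. Problem (P) with spectral parameter $\lambda\in\mathbb{C}$: $\ell y=\lambda y$ on $(-a,0)$ and on $(0,b)$, with $y,y',\ell y$ restricted to $(-a,0)$ in $L^2(-a,0)$ and restricted to $(0,b)$ in $L^2(0,b)$; boundary conditions $y(-a)\cos\alpha=y'(-a)\sin\alpha$ and $y(b)\cos\beta=y'(b)\sin\beta$; transmission conditions $y(0^+)\mu(\lambda)=\Delta' y$ and $y'(0^-)\nu(\lambda)=\Delta y$. If $\lambda$ is a pole of $\mu$, the first transmission condition is read as $y(0^+)=0$; if $\lambda$ is a pole of $\nu$, the second is read as $y'(0^-)=0$. $\lambda$ is an eigenvalue if (P) has a non-zero solution $y$ (eigenfunction), and its geometric multiplicity is the dimension of the solution space. Operator $L$: let $\mathcal H=L^2(-a,b)\oplus\mathbb{C}^{N^*}\oplus\mathbb{C}^{M^*}$, where $N^*=N'$ if $\eta>0$, $N^*=N$ if $\eta=0$, $M^*=M'$ if $\kappa>0$, $M^*=M$ if $\kappa=0$, with inner product $\langle Y,Z\rangle=\int_{-a}^b y\bar z\,dx+\langle\mathbf y^1,\mathbf z^1\rangle+\langle\mathbf y^2,\mathbf z^2\rangle$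 (Euclidean inner products on the last two components). For $Y=(y,\mathbf y^1,\mathbf y^2)$ set $LY=(\ell y,[LY]_1,[LY]_2)$, where $[LY]_1=\boldsymbol\beta\Delta' y+[\gamma_i]\mathbf y^1$ if $\eta>0$, $[LY]_1=\mathbf b\,y(0^+)+[c_i]\mathbf y^1$ if $\eta=0$; $[LY]_2=\boldsymbol\alpha\Delta y+[\delta_j]\mathbf y^2$ if $\kappa>0$, $[LY]_2=\mathbf a\,y'(0^-)+[d_j]\mathbf y^2$ if $\kappa=0$. The domain $\mathcal D(L)$ consists of all $Y\in\mathcal H$ such that $y_1:=y|_{(-a,0)}$ has $y_1,y_1',\ell y_1\in L^2(-a,0)$ and $y(-a)\cos\alpha=y'(-a)\sin\alpha$; $y_2:=y|_{(0,b)}$ has $y_2,y_2',\ell y_2\in L^2(0,b)$ and $y(b)\cos\beta=y'(b)\sin\beta$; $-y(0^+)+\sigma\Delta' y-\langle\mathbf y^1,\boldsymbol\beta\rangle=0$ if $\eta>0$, $\ \Delta' y-\xi y(0^+)-\langle\mathbf y^1,\mathbf b\rangle=0$ if $\eta=0$; $y'(0^-)-\tau\Delta y-\langle\mathbf y^2,\boldsymbol\alpha\rangle=0$ if $\kappa>0$, $\ -\Delta y+\zeta y'(0^-)-\langle\mathbf y^2,\mathbf a\rangle=0$ if $\kappa=0$. *)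

(* Defs.v *)
From HB Require Import structures.
From mathcomp Require Import all_boot all_order all_algebra ring_quotient.
From mathcomp Require Import all_classical all_reals all_analysis.
From mathcomp Require Export complex.

Set Implicit Arguments.
Unset Strict Implicit.
Unset Printing Implicit Defensive.

Import Order.TTheory GRing.Theory Num.Theory.
Import numFieldNormedType.Exports.

Local Notation Re := complex.Re.
Local Notation Im := complex.Im.

Local Open Scope classical_set_scope.
Local Open Scope complex_scope.
Local Open Scope ring_scope.

Section L2.
Context {R : realType}.
Implicit Types (s t : R) (f g : R -> R[i]^o).

Definition L2on s t f : Prop :=
  (((fun x => Re (f x)) \_ `]s, t[ : R -> R) \in Lfun lebesgue_measure 2%:E) /\
  (((fun x => Im (f x)) \_ `]s, t[ : R -> R) \in Lfun lebesgue_measure 2%:E).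

Definition ae_eq_on s t f g : Prop :=
  ae_eq lebesgue_measure `]s, t[%classic f g.

Definition L2pred s t : {pred R -> R[i]^o} := fun f => `[< L2on s t f >].

Lemma L2predP s t f : reflect (L2on s t f) (f \in L2pred s t).
Proof. by rewrite unfold_in; exact: asboolP. Qed.

Lemma ReD_fun (z w : R[i]) : Re (z + w) = Re z + Re w.
Proof. by case: z => ? ?; case: w. Qed.

Lemma ImD_fun (z w : R[i]) : Im (z + w) = Im z + Im w.
Proof. by case: z => ? ?; case: w. Qed.

Lemma ReM_fun (z w : R[i]) : Re (z * w) = Re z * Re w - Im z * Im w.
Proof. by case: z => ? ?; case: w. Qed.

Lemma ImM_fun (z w : R[i]) : Im (z * w) = Re z * Im w + Im z * Re w.
Proof. by case: z => ? ?; case: w. Qed.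

Lemma Lfun2_lin (k l : R) (f g : R -> R) :
  f \in Lfun lebesgue_measure 2%:E -> g \in Lfun lebesgue_measure 2%:E ->
  (fun x => k * f x + l * g x) \in Lfun lebesgue_measure 2%:E.
Proof.
move=> fL gL; have [L0 LD] := Lfun_submod_closed lebesgue_measure (@lee1n R 2).
have -> : (fun x => k * f x + l * g x) = k *: f + (l *: g + 0).
  by apply/funext => x; rewrite addr0.
exact: LD k f (l *: g + 0) fL (LD l g 0 gL L0).
Qed.

Lemma L2pred_submod s t : submod_closed (L2pred s t).
Proof.
have L0 := (Lfun_submod_closed lebesgue_measure (@lee1n R 2)).1.
split.
  apply/L2predP; split;
    by rewrite (_ : _ \_ _ = 0) //; apply/funext => x; rewrite patchE; case: ifP.
move=> k f g /L2predP[fr fi] /L2predP[gr gi]; apply/L2predP; split.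
- rewrite (_ : _ \_ _ = (fun x => 1 * (Re k * ((fun x => Re (f x)) \_ `]s, t[) x
    + - Im k * ((fun x => Im (f x)) \_ `]s, t[) x)
    + 1 * ((fun x => Re (g x)) \_ `]s, t[) x)).
    exact: (Lfun2_lin 1 1 (Lfun2_lin (Re k) (- Im k) fr fi) gr).
  apply/funext => x; rewrite !patchE; case: ifP => _.
    by rewrite fctE ReD_fun ReM_fun !mul1r mulNr.
  rewrite !(mulr0, addr0); exact: erefl.
- rewrite (_ : _ \_ _ = (fun x => 1 * (Re k * ((fun x => Im (f x)) \_ `]s, t[) x
    + Im k * ((fun x => Re (f x)) \_ `]s, t[) x)
    + 1 * ((fun x => Im (g x)) \_ `]s, t[) x)).
    exact: (Lfun2_lin 1 1 (Lfun2_lin (Re k) (Im k) fi fr) gi).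
  apply/funext => x; rewrite !patchE; case: ifP => _.
    by rewrite fctE ImD_fun ImM_fun !mul1r.
  rewrite !(mulr0, addr0); exact: erefl.
Qed.

HB.instance Definition _ s t :=
  GRing.isSubmodClosed.Build R[i] (R -> R[i]^o) (L2pred s t)
    (L2pred_submod s t).

Record L2fun s t := MkL2fun { L2val :> R -> R[i]^o; _ : L2val \in L2pred s t }.

HB.instance Definition _ s t := [isSub for @L2val s t].
HB.instance Definition _ s t := [Choice of L2fun s t by <:].
HB.instance Definition _ s t := [SubChoice_isSubLmodule of L2fun s t by <:].

Definition L2null s t : {pred L2fun s t} := fun h : L2fun s t => `[< ae_eq_on s t h 0 >].

Lemma L2nullP s t (f : L2fun s t) :
  reflect (ae_eq_on s t f 0) (f \in @L2null s t).
Proof. by rewrite unfold_in; exact: asboolP. Qed.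

Lemma L2null_submod s t : submod_closed (@L2null s t).
Proof.
split; first by apply/L2nullP; apply: aeW.
move=> k f g /L2nullP f0 /L2nullP g0; apply/L2nullP.
move: f0 g0; rewrite /ae_eq_on; apply: filterS2 => x fx gx xI.
have -> : (k *: f + g : L2fun s t) x = k * (f : R -> R[i]^o) x + (g : R -> R[i]^o) x by [].
by rewrite fx // gx // addr0 mulr0.
Qed.

HB.instance Definition _ s t :=
  GRing.isSubmodClosed.Build R[i] (L2fun s t) (@L2null s t)
    (@L2null_submod s t).

Definition L2 s t : Type := Quotient.quot (@L2null s t).
HB.instance Definition _ s t := GRing.Zmodule.on (L2 s t).
HB.instance Definition _ s t := EqQuotient.on (L2 s t).

Local Open Scope quotient_scope.

Lemma L2piD s t (f g : L2fun s t) :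
  \pi_(L2 s t) (f + g) = \pi_(L2 s t) f + \pi_(L2 s t) g.
Proof. exact: Quotient.pi_add. Qed.

Lemma L2piP s t (f g : L2fun s t) :
  \pi_(L2 s t) f = \pi_(L2 s t) g <-> f - g \in @L2null s t.
Proof.
rewrite (Quotient.idealrBE (@L2null s t)).
by split=> [->|/eqP].
Qed.

Definition L2scale s t (k : R[i]) (u : L2 s t) : L2 s t :=
  \pi_(L2 s t) (k *: repr u).

Lemma L2scale_pi s t k (f : L2fun s t) :
  L2scale k (\pi_(L2 s t) f) = \pi_(L2 s t) (k *: f).
Proof.
by apply/L2piP; rewrite -scalerBr rpredZ //; apply/L2piP; rewrite reprK.
Qed.

Lemma L2_surj s t (u : L2 s t) : exists f : L2fun s t, u = \pi_(L2 s t) f.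
Proof. by exists (repr u); rewrite reprK. Qed.

Let L2scaleA s t k l (u : L2 s t) : L2scale k (L2scale l u) = L2scale (k * l) u.
Proof. by have [f ->] := L2_surj u; rewrite !L2scale_pi scalerA. Qed.

Let L2scale1 s t : left_id 1 (@L2scale s t).
Proof. by move=> u; have [f ->] := L2_surj u; rewrite L2scale_pi scale1r. Qed.

Let L2scaleDr s t : right_distributive (@L2scale s t) +%R.
Proof.
move=> k u v; have [f ->] := L2_surj u; have [g ->] := L2_surj v.
by rewrite -L2piD !L2scale_pi scalerDr L2piD.
Qed.

Let L2scaleDl s t (u : L2 s t) :
  {morph (@L2scale s t)^~ u : k l / k + l}.
Proof.
by move=> k l; have [f ->] := L2_surj u; rewrite !L2scale_pi scalerDl L2piD.
Qed.

HB.instance Definition _ s t :=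
  GRing.Zmodule_isLmodule.Build R[i] (L2 s t)
    (@L2scaleA s t) (@L2scale1 s t) (@L2scaleDr s t) (@L2scaleDl s t).

(* The class of f; by convention the class of 0 if f is not square
   integrable on ]s, t[. *)
Definition L2class s t f : L2 s t := \pi_(L2 s t) (insubd (0 : L2fun s t) f).

Lemma L2classP s t f g : L2on s t f -> L2on s t g ->
  L2class s t f = L2class s t g <-> ae_eq_on s t f g.
Proof.
move=> /L2predP fL /L2predP gL; rewrite /L2class L2piP.
have E x : (insubd 0 f - insubd 0 g : L2fun s t) x = f x - g x.
  have -> : f x - g x =
      L2val (insubd (0 : L2fun s t) f) x - L2val (insubd (0 : L2fun s t) g) x.
    by rewrite [L2val _](insubdK _ fL) [L2val (insubd _ g)](insubdK _ gL).
  by [].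
split=> [/L2nullP|] fg; last apply/L2nullP; move: fg; rewrite /ae_eq_on;
  apply: filterS => x h xI; apply/eqP.
  by rewrite -subr_eq0 -E h.
by rewrite E h // subrr.
Qed.

End L2.

Section Calculus.
Context {R : realType}.
Implicit Types (s t x : R) (f : R -> R[i]^o).

(* y(x^+) and y(x^-) *)
Definition rlimit f x : R[i] :=
  lim (Re (f u) @[u --> x^'+]) +i* lim (Im (f u) @[u --> x^'+]).

Definition llimit f x : R[i] :=
  lim (Re (f u) @[u --> x^'-]) +i* lim (Im (f u) @[u --> x^'-]).

Definition cderivable f x : Prop :=
  derivable (fun u => Re (f u)) x 1 /\ derivable (fun u => Im (f u)) x 1.

(* derive1 is 0 at points where the derivative does not exist. *)
Definition cderive f : R -> R[i]^o :=
  fun x => derive1 (fun u => Re (f u)) x +i* derive1 (fun u => Im (f u)) x.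

Definition abs_continuous s t (f : R -> R) : Prop :=
  forall e, 0 < e -> exists2 d, 0 < d &
    forall n (u v : 'I_n -> R),
      (forall i, s < u i /\ u i <= v i /\ v i < t) ->
      trivIset [set: 'I_n] (fun i => `]u i, v i[%classic) ->
      \sum_i (v i - u i) < d -> \sum_i `|f (v i) - f (u i)| < e.

Definition cabs_continuous s t f : Prop :=
  abs_continuous s t (fun u => Re (f u)) /\
  abs_continuous s t (fun u => Im (f u)).

Definition sturm_liouville (q f : R -> R[i]^o) : R -> R[i]^o :=
  fun x => - cderive (cderive f) x + q x * f x.

(* "f, f' and l f are in L^2(s, t)".  As usual for the expression l, this
   presupposes that f and f' are absolutely continuous, so that f'' exists
   almost everywhere; since ]s, t[ is bounded and f', f'' are integrable on it,
   local absolute continuity and absolute continuity on ]s, t[ are the same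
   thing here. *)
Definition sl_regular q s t f : Prop :=
  [/\ forall x, x \in `]s, t[ -> cderivable f x,
      cabs_continuous s t f,
      cabs_continuous s t (cderive f) &
      [/\ L2on s t f, L2on s t (cderive f) & L2on s t (sturm_liouville q f)]].

End Calculus.

Section Algebra.
Context {R : realType}.

Definition has_dim (K : fieldType) (V : lmodType K) (S : set V) (n : nat) : Prop :=
  exists e : 'I_n -> V,
    (forall k : 'I_n -> K, \sum_i k i *: e i = 0 -> forall i, k i = 0) /\
    S = [set \sum_i k i *: e i | k in [set: 'I_n -> K]].

Definition cvec n (w : 'I_n -> R) : 'cV[R[i]]_n := \col_i (w i)%:C.

Definition cdiag n (w : 'I_n -> R) : 'M[R[i]]_n := diag_mx (\row_i (w i)%:C).

Definition euclid n (u v : 'cV[R[i]]_n) : R[i] := \sum_i u i 0 * conjc (v i 0).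

(* The weights w_i and poles p_i of a sum of w_i^2 / (lambda - p_i). *)
Record fractions := Fractions {
  fsize : nat;
  fweight : 'I_fsize -> R;
  fpole : 'I_fsize -> R }.
Arguments fweight : clear implicits.
Arguments fpole : clear implicits.

Definition fractions_sum (F : fractions) (lambda : R[i]) : R[i] :=
  \sum_(i < fsize F) (fweight F i ^+ 2)%:C / (lambda - (fpole F i)%:C).

Definition is_pole (F : fractions) (lambda : R[i]) : Prop :=
  exists i, lambda = (fpole F i)%:C.

Definition fractions_ok (F : fractions) : Prop :=
  (forall i j : 'I_(fsize F), (i < j)%N -> fpole F i < fpole F j) /\
  (forall i : 'I_(fsize F), 0 < fweight F i).

(* (lambda I - [p])^-1 w z  if lambda is none of the p_i, and
   (z' / w_I) e^I  if lambda = p_I. *)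
Definition component (F : fractions) (lambda z z' : R[i]) : 'cV[R[i]]_(fsize F) :=
  if [pick i | lambda == (fpole F i)%:C] is Some i0
  then (z' / (fweight F i0)%:C) *: delta_mx i0 0
  else z *: (invmx (lambda%:M - cdiag (fpole F)) *m cvec (fweight F)).

End Algebra.
Arguments fractions : clear implicits.
Arguments fweight {R} f i.
Arguments fpole {R} f i.

Record sl_data (R : realType) := SLData {
  sl_a : R;
  sl_b : R;
  sl_q : R -> R[i]^o;
  sl_alpha : R;
  sl_beta : R;
  (* sl_mu lambda = - (lambda eta - xi - sum_i b_i^2 / (lambda - c_i)) *)
  sl_eta : R;
  sl_xi : R;
  sl_bc : fractions R;
  (* sl_nu lambda = lambda kappa + zeta - sum_j a_j^2 / (lambda - d_j) *)
  sl_kappa : R;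
  sl_zeta : R;
  sl_ad : fractions R;
  (* 1 / sl_mu lambda = sigma - sum_i beta_i^2 / (lambda - gamma_i), if eta > 0 *)
  sl_sigma : R;
  sl_betagamma : fractions R;
  (* 1 / sl_nu lambda = tau + sum_j alpha_j^2 / (lambda - delta_j), if kappa > 0 *)
  sl_tau : R;
  sl_alphadelta : fractions R }.

Section Problems.
Context {R : realType} (D : sl_data R).
Implicit Types (lambda : R[i]) (y : R -> R[i]^o).

Local Notation a := (sl_a D).
Local Notation b := (sl_b D).
Local Notation eta := (sl_eta D).
Local Notation kappa := (sl_kappa D).
Local Notation ell := (sturm_liouville (sl_q D)).

Definition sl_mu lambda : R[i] :=
  - (lambda * eta%:C - (sl_xi D)%:C - fractions_sum (sl_bc D) lambda).

Definition sl_nu lambda : R[i] :=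
  lambda * kappa%:C + (sl_zeta D)%:C - fractions_sum (sl_ad D) lambda.

(* The partial fraction expansions of 1/mu and 1/nu are identities of rational
   functions, hence are required only where both sides are defined. *)
Record sl_admissible : Prop := SLAdmissible {
  sl_a_gt0 : 0 < a;
  sl_b_gt0 : 0 < b;
  sl_q_L2 : L2on (- a) b (sl_q D);
  sl_alpha_itv : sl_alpha D \in `[0, pi[;
  sl_beta_itv : sl_beta D \in `]0, pi];
  sl_eta_ge0 : 0 <= eta;
  sl_kappa_ge0 : 0 <= kappa;
  sl_bc_ok : fractions_ok (sl_bc D);
  sl_ad_ok : fractions_ok (sl_ad D);
  sl_inv_mu : 0 < eta ->
    [/\ (0 < fsize (sl_betagamma D))%N, fractions_ok (sl_betagamma D) &
        forall lambda, ~ is_pole (sl_bc D) lambda -> sl_mu lambda != 0 ->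
          ~ is_pole (sl_betagamma D) lambda ->
          (sl_mu lambda)^-1 =
            (sl_sigma D)%:C - fractions_sum (sl_betagamma D) lambda];
  sl_inv_nu : 0 < kappa ->
    [/\ (0 < fsize (sl_alphadelta D))%N, fractions_ok (sl_alphadelta D) &
        forall lambda, ~ is_pole (sl_ad D) lambda -> sl_nu lambda != 0 ->
          ~ is_pole (sl_alphadelta D) lambda ->
          (sl_nu lambda)^-1 =
            (sl_tau D)%:C + fractions_sum (sl_alphadelta D) lambda] }.

(* A function on (-a,0) u (0,b) is encoded by its extension by 0 to R, so that
   equality of such functions is equality in R -> R[i]. *)
Definition on_domain y : Prop :=
  forall x, x \notin `](- a), 0[ -> x \notin `]0, b[ -> y x = 0.

Definition piecewise_regular y : Prop :=
  [/\ on_domain y, sl_regular (sl_q D) (- a) 0 y & sl_regular (sl_q D) 0 b y].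

Definition boundary_conditions y : Prop :=
  rlimit y (- a) * (cos (sl_alpha D))%:C =
    rlimit (cderive y) (- a) * (sin (sl_alpha D))%:C /\
  llimit y b * (cos (sl_beta D))%:C =
    llimit (cderive y) b * (sin (sl_beta D))%:C.

Definition jump y : R[i] := rlimit y 0 - llimit y 0.

Definition jump' y : R[i] := rlimit (cderive y) 0 - llimit (cderive y) 0.

Definition transmission_mu lambda y : Prop :=
  (is_pole (sl_bc D) lambda -> rlimit y 0 = 0) /\
  (~ is_pole (sl_bc D) lambda -> rlimit y 0 * sl_mu lambda = jump' y).

Definition transmission_nu lambda y : Prop :=
  (is_pole (sl_ad D) lambda -> llimit (cderive y) 0 = 0) /\
  (~ is_pole (sl_ad D) lambda -> llimit (cderive y) 0 * sl_nu lambda = jump y).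

Definition solutionsP lambda : set (R -> R[i]^o) :=
  [set y | [/\ piecewise_regular y,
      ae_eq_on (- a) 0 (ell y) (lambda *: y) /\
      ae_eq_on 0 b (ell y) (lambda *: y),
      boundary_conditions y,
      transmission_mu lambda y &
      transmission_nu lambda y]].

Definition eigenfunctionP lambda y : Prop :=
  solutionsP lambda y /\ y <> 0.

Definition fractions1 : fractions R :=
  if 0 < eta then sl_betagamma D else sl_bc D.

Definition fractions2 : fractions R :=
  if 0 < kappa then sl_alphadelta D else sl_ad D.

Local Notation w1 := (cvec (fweight fractions1)).
Local Notation w2 := (cvec (fweight fractions2)).

(* The inner product of the Hilbert space plays no role in the eigenvalue
   equation; only the vector space structure is recorded. *)
Definition spaceH : lmodType R[i] :=
  (L2 (- a) b * 'cV[R[i]]_(fsize fractions1) * 'cV[R[i]]_(fsize fractions2))%type.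

Definition represents y (u : L2 (- a) b) : Prop :=
  piecewise_regular y /\ L2class (- a) b y = u.

(* The regular representative of the class u, unique if it exists. *)
Definition representative (u : L2 (- a) b) : R -> R[i]^o :=
  xget 0 [set y | represents y u].

Definition domainL : set spaceH := [set Y |
  let y := representative Y.1.1 in
  let y1 := Y.1.2 in
  let y2 := Y.2 in
  [/\ represents y Y.1.1,
      boundary_conditions y,
      (if 0 < eta
       then - rlimit y 0 + (sl_sigma D)%:C * jump' y - euclid y1 w1 = 0
       else jump' y - (sl_xi D)%:C * rlimit y 0 - euclid y1 w1 = 0) &
      (if 0 < kappa
       then llimit (cderive y) 0 - (sl_tau D)%:C * jump y - euclid y2 w2 = 0
       else - jump y + (sl_zeta D)%:C * llimit (cderive y) 0 - euclid y2 w2 = 0)]].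

Definition opL (Y : spaceH) : spaceH :=
  let y := representative Y.1.1 in
  (L2class (- a) b (ell y),
   (if 0 < eta then jump' y else rlimit y 0) *: w1
     + cdiag (fpole fractions1) *m Y.1.2,
   (if 0 < kappa then jump y else llimit (cderive y) 0) *: w2
     + cdiag (fpole fractions2) *m Y.2).

Definition eigenspaceL lambda : set spaceH :=
  [set Y | domainL Y /\ opL Y = lambda *: Y].

Definition eigenvectorL lambda (Y : spaceH) : Prop :=
  eigenspaceL lambda Y /\ Y <> 0.

Definition component1 lambda y : 'cV[R[i]]_(fsize fractions1) :=
  if 0 < eta then component fractions1 lambda (jump' y) (- rlimit y 0)
  else component fractions1 lambda (rlimit y 0) (jump' y).

Definition component2 lambda y : 'cV[R[i]]_(fsize fractions2) :=
  if 0 < kappa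
  then component fractions2 lambda (jump y) (llimit (cderive y) 0)
  else component fractions2 lambda (llimit (cderive y) 0) (- jump y).

End Problems.
Arguments eigenspaceL {R} D lambda.
Arguments eigenvectorL {R} D lambda Y.

(* Main.v *)
Require Import Defs.
From mathcomp Require Import all_boot all_order all_algebra ring_quotient.
From mathcomp Require Import all_classical all_reals all_analysis.
From mathcomp Require Import measurable_realfun ring.

Set Implicit Arguments.
Unset Strict Implicit.
Unset Printing Implicit Defensive.

Import Order.TTheory GRing.Theory Num.Theory.
Import numFieldNormedType.Exports.

Local Notation Re := complex.Re.
Local Notation Im := complex.Im.

Local Open Scope classical_set_scope.
Local Open Scope complex_scope.
Local Open Scope ring_scope.

(** The classes in L^2(-a, b) of the eigenvalue problem for L and the functions
    of problem (P) carry the same information: a function that vanishes outside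
    (-a, 0) u (0, b) and is differentiable there is determined by its class,
    since two continuous functions that agree almost everywhere on an open
    interval agree on it ([ae_eq_cont], [tame_class_inj]).  Hence the first
    component of L Y = lambda Y is exactly the differential equation of (P).

    What remains is algebra in the four numbers y(0^+), y(0^-), y'(0^+),
    y'(0^-).  In each of the four cases (eta or kappa positive or zero) the
    equations for a vector component read
      z w_i + p_i v_i = lambda v_i   and   <v, w> = s (x - e z),   s = 1 or -1,
    where w and p are the weights and poles of one of the given sums of
    fractions S.  If lambda is not a pole, the first equation gives
    v_i = z w_i / (lambda - p_i), and then the second says
    z (e + s S(lambda)) = x; if lambda = p_I it gives z = 0 and v_i = 0 for
    i <> I, and the second fixes v_I ([component_affine]).  So v is the
    prescribed component, and (z, x) satisfies the transmission condition with
    the function e + s S.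

    If eta = 0 (or kappa = 0) that function is mu (or nu) itself.  If eta > 0
    (or kappa > 0) it is the partial fraction expansion of the reciprocal, and
    the two transmission conditions are exchanged by inversion.  The delicate
    points are the poles: after multiplication by the denominators the identity
    mu (1/mu) = 1 becomes an identity P Q = A B of polynomials, where the
    numerators P, Q do not vanish at the roots of the denominators A, B.  It
    follows that at a pole of either function the other one is regular and
    vanishes ([pfrac_reciprocal]).

    Therefore the eigenspace of L is the image of the solution space of (P)
    under y |-> (class of y, component 1, component 2) ([eigenspaceLE]).  This
    map is linear and injective on a vector space that contains all solutions:
    the functions with first derivatives on both intervals and one-sided limits
    at 0 up to first order.  On it dimensions are transferred
    ([has_dim_image]). *)

(** * Rational functions given by partial fractions *)
Section PartialFractions.
Context {K : fieldType}.
Implicit Types (l s : K) (u : {poly K}).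

Definition pfrac n (c p : 'I_n -> K) l : K := \sum_i c i / (l - p i).

Definition denominator n (p : 'I_n -> K) : {poly K} := \prod_j ('X - (p j)%:P).

(** The function [u + s * pfrac c p] multiplied by [denominator p]. *)
Definition numerator n (c p : 'I_n -> K) u s : {poly K} :=
  u * denominator p
    + s *: \sum_i c i *: \prod_(j < n | j != i) ('X - (p j)%:P).

Lemma denominator_root n (p : 'I_n -> K) l :
  reflect (exists i, l = p i) (root (denominator p) l).
Proof.
rewrite /root horner_prod; apply: (iffP (prodf_eq0 _ _)).
  by move=> [i _]; rewrite hornerXsubC subr_eq0 => /eqP ->; exists i.
by move=> [i ->]; exists i => //; rewrite hornerXsubC subrr.
Qed.

Lemma denominator_neq0 n (p : 'I_n -> K) : denominator p != 0.
Proof. by rewrite monic_neq0 // monic_prod_XsubC. Qed.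

Lemma numerator_nonpole n (c p : 'I_n -> K) u s l : ~ (exists i, l = p i) ->
  (numerator c p u s).[l] = (denominator p).[l] * (u.[l] + s * pfrac c p l).
Proof.
move=> Fl; rewrite /numerator hornerD hornerM hornerZ horner_sum mulrDr mulrC.
congr (_ + _); rewrite mulrCA; congr (_ * _).
rewrite /pfrac mulr_sumr; apply: eq_bigr => i _.
have li : l - p i != 0 by rewrite subr_eq0; apply/eqP => e; apply: Fl; exists i.
rewrite hornerZ [denominator p](bigD1 i) //= hornerM hornerXsubC.
by field.
Qed.

(** At a pole [p i] only the [i]-th term of the sum survives, and it is a product
    of differences of distinct poles: nothing cancels in the fraction. *)
Lemma numerator_pole n (c p : 'I_n -> K) u s l :
  injective p -> (forall i, c i != 0) -> s != 0 -> (exists i, l = p i) ->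
  (numerator c p u s).[l] != 0.
Proof.
move=> pI c0 s0 [i ->].
have pE j : j != i -> p i - p j != 0.
  by rewrite subr_eq0; apply: contraNneq => /pI ->.
rewrite /numerator hornerD hornerM hornerZ horner_sum.
have -> : (denominator p).[p i] = 0 by apply/eqP/denominator_root; exists i.
rewrite mulr0 add0r mulf_neq0 // (bigD1 i) //= [X in _ + X]big1 ?addr0.
  rewrite hornerZ mulf_neq0 // horner_prod.
  by apply/prodf_neq0 => j ji; rewrite hornerXsubC pE.
move=> j ji; rewrite hornerZ horner_prod (bigD1 i) 1?eq_sym //=.
by rewrite hornerXsubC subrr mul0r mulr0.
Qed.

(** With at least one fraction the value at a pole shows it; without fractions
    the numerator is [u]. *)
Lemma numerator_neq0 n (c p : 'I_n -> K) u s :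
  injective p -> (forall i, c i != 0) -> u != 0 -> s != 0 ->
  numerator c p u s != 0.
Proof.
case: n c p => [|n] c p pI c0 u0 s0.
  by rewrite /numerator /denominator !big_ord0 scaler0 addr0 mulr1.
have lF : exists i, p ord0 = p i by exists ord0.
by apply: contraNneq (numerator_pole u pI c0 s0 lF) => ->; rewrite horner0.
Qed.

End PartialFractions.

(** Clearing denominators turns the relation [f * g = 1], known away from the poles
    and the zeros of [f], into an identity between polynomials at all but finitely
    many points, hence everywhere.  As no fraction cancels, each of [f] and [g]
    vanishes exactly at the poles of the other. *)
Lemma pfrac_reciprocal (K : closedFieldType) n m (c p : 'I_n -> K)
    (d q : 'I_m -> K) (u : {poly K}) (s e t : K) :
  injective p -> injective q ->
  (forall i, c i != 0) -> (forall i, d i != 0) ->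
  u != 0 -> s != 0 -> t != 0 ->
  let f l := u.[l] + s * pfrac c p l in
  let g l := e + t * pfrac d q l in
  (forall l, ~ (exists i, l = p i) -> f l != 0 -> ~ (exists i, l = q i) ->
     (f l)^-1 = g l) ->
  forall l,
    [/\ ~ (exists i, l = p i) -> ~ (exists i, l = q i) -> f l * g l = 1,
        (exists i, l = p i) -> ~ (exists i, l = q i) /\ g l = 0 &
        (exists i, l = q i) -> ~ (exists i, l = p i) /\ f l = 0].
Proof.
move=> pI qI c0 d0 u0 s0 t0 f g fg.
pose P := numerator c p u s; pose Q := numerator d q e%:P t.
pose A := denominator p; pose B := denominator q.
have PA l : ~ (exists i, l = p i) -> P.[l] = A.[l] * f l.
  exact: numerator_nonpole.
have QB l : ~ (exists i, l = q i) -> Q.[l] = B.[l] * g l.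
  by move=> ql; rewrite /Q numerator_nonpole // hornerC.
have Ppole l : (exists i, l = p i) -> P.[l] != 0 by exact: numerator_pole.
have Qpole l : (exists i, l = q i) -> Q.[l] != 0 by exact: numerator_pole.
have A_root l : reflect (exists i, l = p i) (root A l) by exact: denominator_root.
have B_root l : reflect (exists i, l = q i) (root B l) by exact: denominator_root.
have P0 : P != 0 by exact: numerator_neq0.
have [A0 B0] : A != 0 /\ B != 0 by split; exact: denominator_neq0.
clearbody P Q A B.
have AN0 l : ~ (exists i, l = p i) -> A.[l] != 0 by move/A_root.
have BN0 l : ~ (exists i, l = q i) -> B.[l] != 0 by move/B_root.
have PQAB : P * Q = A * B.
  apply/eqP; rewrite -subr_eq0; apply: contraT => D0.
  (* The extra factors P, A, B cover the points where the hypothesis says nothing. *)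
  have : P * (P * Q - A * B) * A * B != 0.
    by rewrite !mulf_neq0.
  case/closed_nonrootP => l /negP[]; rewrite /root !hornerE.
  have [/A_root/eqP ->|pl] := pselect (exists i, l = p i).
    by rewrite mulr0 mul0r.
  have [/B_root/eqP ->|ql] := pselect (exists i, l = q i).
    by rewrite mulr0.
  rewrite PA // QB //; have [->|f0] := eqVneq (f l) 0.
    by rewrite mulr0 !mul0r.
  have fg1 : f l * g l = 1 by rewrite -fg // divff.
  by rewrite [_ * _ * (B.[l] * _)]mulrACA fg1 mulr1 subrr mulr0 !mul0r.
move=> l; have := congr1 (horner^~ l) PQAB; rewrite /= !hornerM => PQl.
split=> [pl ql|pl|ql].
- move: PQl; rewrite PA // QB // mulrACA -[RHS]mulr1 => /mulfI -> //.
  by rewrite mulf_neq0 ?AN0 ?BN0.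
- move: PQl; have/A_root/eqP -> := pl; rewrite mul0r => /eqP.
  rewrite mulf_eq0 (negPf (Ppole _ pl)) /= => Ql0.
  have ql : ~ (exists i, l = q i) by move/Qpole; rewrite Ql0.
  split=> //; move: Ql0; rewrite QB // mulf_eq0 (negPf (BN0 _ ql)).
  by move/eqP.
- move: PQl; have/B_root/eqP -> := ql; rewrite mulr0 => /eqP.
  rewrite mulf_eq0 (negPf (Qpole _ ql)) orbF => Pl0.
  have pl : ~ (exists i, l = p i) by move/Ppole; rewrite Pl0.
  split=> //; move: Pl0; rewrite PA // mulf_eq0 (negPf (AN0 _ pl)).
  by move/eqP.
Qed.

(** * The vector components and the transmission conditions *)
Section Fractions.
Context {R : realType}.
Implicit Types (F G : fractions R) (l z : R[i]).

Lemma fpole_inj F : fractions_ok F -> injective (fun i => (fpole F i)%:C).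
Proof.
move=> [Fp _] i j /complexI e.
by case: (ltngtP i j) => [/Fp|/Fp|/val_inj //]; rewrite e ltxx.
Qed.

Lemma fweight_neq0 F i : fractions_ok F -> (fweight F i)%:C != 0 :> R[i].
Proof.
by move=> [_ Fw]; rewrite (fmorph_eq0 (real_complex R)) gt_eqF.
Qed.

Lemma fweight2_neq0 F i : fractions_ok F -> (fweight F i ^+ 2)%:C != 0 :> R[i].
Proof.
by move=> [_ Fw]; rewrite (fmorph_eq0 (real_complex R)) expf_neq0 ?gt_eqF.
Qed.

Lemma fractions_reciprocal F G (c d s e t : R[i]) :
  fractions_ok F -> fractions_ok G -> d != 0 -> s != 0 -> t != 0 ->
  let f l := c + d * l + s * fractions_sum F l in
  let g l := e + t * fractions_sum G l in
  (forall l, ~ is_pole F l -> f l != 0 -> ~ is_pole G l -> (f l)^-1 = g l) ->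
  forall l, [/\ ~ is_pole F l -> ~ is_pole G l -> f l * g l = 1,
                is_pole F l -> ~ is_pole G l /\ g l = 0 &
                is_pole G l -> ~ is_pole F l /\ f l = 0].
Proof.
move=> Fok Gok d0 s0 t0 f g fg.
pose u : {poly R[i]} := c%:P + d *: 'X.
have uE l : u.[l] = c + d * l by rewrite !hornerE.
have u0 : u != 0.
  apply: contraNneq d0 => u0; have := congr1 (coefp 1) u0.
  by rewrite /u /= coefD coefC coefZ coefX coef0 /= add0r mulr1 => ->.
move=> l; rewrite /f -uE.
apply: (pfrac_reciprocal (fpole_inj Fok) (fpole_inj Gok)) => //.
- by move=> i; exact: fweight2_neq0.
- by move=> i; exact: fweight2_neq0.
by move=> k; rewrite uE => Fk fk Gk; exact: fg.
Qed.

(** The transmission condition with coefficient [m] (poles [F]) and its inverse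
    form with coefficient [r = 1 / m] (poles [G]) agree also at the poles, because
    a pole of one coefficient is a zero of the other. *)
Lemma transmission_reciprocal F G (l m r x z : R[i]) :
  (~ is_pole F l -> ~ is_pole G l -> m * r = 1) ->
  (is_pole F l -> ~ is_pole G l /\ r = 0) ->
  (is_pole G l -> ~ is_pole F l /\ m = 0) ->
  ((is_pole F l -> x = 0) /\ (~ is_pole F l -> x * m = z)) <->
  ((is_pole G l -> z = 0) /\ (~ is_pole G l -> z * r = x)).
Proof.
move=> mr1 Fr Gm; split=> -[h1 h2]; split.
- by move=> Gl; have [Fl m0] := Gm Gl; rewrite -h2 // m0 mulr0.
- move=> Gl; have [Fl|Fl] := pselect (is_pole F l).
    by rewrite h1 // (Fr Fl).2 mulr0.
  by rewrite -h2 // -mulrA mr1 // mulr1.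
- by move=> Fl; have [Gl r0] := Fr Fl; rewrite -h2 // r0 mulr0.
- move=> Fl; have [Gl|Gl] := pselect (is_pole G l).
    by rewrite h1 // (Gm Gl).2 mulr0.
  by rewrite -h2 // -mulrA [r * _]mulrC mr1 // mulr1.
Qed.

Lemma euclid_cvec n (y : 'cV[R[i]]_n) (w : 'I_n -> R) :
  euclid y (cvec w) = \sum_i y i 0 * (w i)%:C.
Proof.
by apply: eq_bigr => i _; rewrite mxE; congr (_ * _); apply: conjc_real.
Qed.

Lemma eigen_component_entry F l z (y : 'cV[R[i]]_(fsize F)) :
  (z *: cvec (fweight F) + cdiag (fpole F) *m y = l *: y) <->
  (forall i, (l - (fpole F i)%:C) * y i 0 = z * (fweight F i)%:C).
Proof.
rewrite /cdiag mul_diag_mx; split=> [/matrixP e i|e].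
  by have := e i 0; rewrite !mxE => ei; rewrite mulrBl -ei addrK.
by apply/matrixP => i j; rewrite (ord1 j) !mxE -e mulrBl subrK.
Qed.

Lemma component_nonpole F l z z' i : ~ is_pole F l ->
  component F l z z' i 0 = z * ((fweight F i)%:C / (l - (fpole F i)%:C)).
Proof.
move=> Fl; rewrite /component; case: pickP => [j /eqP lj|_].
  by case: Fl; exists j.
have l0 j : l - (fpole F j)%:C != 0.
  by rewrite subr_eq0; apply/eqP => e; apply: Fl; exists j.
have E : (l%:M - cdiag (fpole F)) *m
    (\col_j ((fweight F j)%:C / (l - (fpole F j)%:C))) = cvec (fweight F).
  apply/matrixP => j k; rewrite -diag_const_mx /cdiag -linearB /= mul_diag_mx !mxE.
  by rewrite mulrC divfK.
have U : l%:M - cdiag (fpole F) \in unitmx.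
  rewrite -diag_const_mx /cdiag -linearB /= unitmxE det_diag unitfE.
  by apply/prodf_neq0 => j _; rewrite !mxE.
by rewrite -E mulKmx // !mxE.
Qed.

Lemma component_pole F l z z' i j : fractions_ok F -> l = (fpole F i)%:C ->
  component F l z z' j 0 = (j == i)%:R * (z' / (fweight F i)%:C).
Proof.
move=> Fok li; rewrite /component; case: pickP => [k /eqP lk|/(_ i)]; last first.
  by rewrite li eqxx.
have <- : k = i by apply: (fpole_inj Fok); rewrite -li -lk.
by rewrite !mxE andbT mulrC.
Qed.

(** The diagonal system for [y] is solvable iff [z] vanishes at a pole; the scalar
    equation then determines the free entry at a pole, and is a condition on [z']
    elsewhere. *)
Lemma componentP F l z z' (y : 'cV[R[i]]_(fsize F)) : fractions_ok F ->
  (z *: cvec (fweight F) + cdiag (fpole F) *m y = l *: y /\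
   euclid y (cvec (fweight F)) = z') <->
  [/\ y = component F l z z', is_pole F l -> z = 0 &
      ~ is_pole F l -> z' = z * fractions_sum F l].
Proof.
move=> Fok; rewrite eigen_component_entry euclid_cvec.
have [[i li]|Fl] := pselect (is_pole F l).
  have lj j : j != i -> l - (fpole F j)%:C != 0.
    rewrite subr_eq0; apply: contraNneq; rewrite li => e.
    by rewrite (fpole_inj Fok e).
  split=> [[e yz']|[-> z0 _]].
    have z0 : z = 0.
      apply/eqP; have /eqP := e i; rewrite -li subrr mul0r eq_sym mulf_eq0.
      by rewrite (negPf (fweight_neq0 i Fok)) orbF.
    have y0 j : j != i -> y j 0 = 0.
      move=> ji; apply/eqP; have /eqP := e j.
      by rewrite z0 mul0r mulf_eq0 (negPf (lj _ ji)).
    split=> //; last by case; exists i.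
    apply/matrixP => j k; rewrite (ord1 k) (component_pole _ _ _ Fok li) -yz'.
    rewrite (bigD1 i) //= big1 => [|m mi]; last by rewrite y0 // mul0r.
    rewrite addr0 mulfK ?fweight_neq0 //.
    have [->|ji] := eqVneq j i; first by rewrite mul1r.
    by rewrite mul0r y0.
  have {}z0 : z = 0 by apply: z0; exists i.
  split=> [j|].
    rewrite (component_pole _ _ _ Fok li) z0 mul0r.
    have [->|ji] := eqVneq j i; first by rewrite li subrr mul0r.
    by rewrite mul0r mulr0.
  rewrite (bigD1 i) //= big1 => [|j ji].
    by rewrite (component_pole _ _ _ Fok li) eqxx mul1r addr0 divfK ?fweight_neq0.
  by rewrite (component_pole _ _ _ Fok li) (negPf ji) !mul0r.
have lj j : l - (fpole F j)%:C != 0.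
  by rewrite subr_eq0; apply/eqP => e; apply: Fl; exists j.
have zE : \sum_i component F l z z' i 0 * (fweight F i)%:C = z * fractions_sum F l.
  rewrite mulr_sumr; apply: eq_bigr => i _; rewrite component_nonpole //.
  by rewrite -mulrA mulrAC -expr2 -rmorphXn.
split=> [[e yz']|[-> _ z'E]].
  have yE : y = component F l z z'.
    apply/matrixP => j k; rewrite (ord1 k) component_nonpole // mulrA -e.
    by rewrite mulrC mulKf.
  by split=> // _; rewrite -zE -yE.
split=> [j|]; last by rewrite zE z'E.
by rewrite component_nonpole // mulrCA [_ * (_ / _)]mulrC divfK.
Qed.

Lemma componentD F l k z1 z1' z2 z2' :
  component F l (k * z1 + z2) (k * z1' + z2') =
  k *: component F l z1 z1' + component F l z2 z2'.
Proof.
rewrite /component; case: pickP => [i _|_].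
  by rewrite mulrDl scalerDl -mulrA scalerA.
by rewrite scalerDl scalerA.
Qed.

Lemma eq_component F l z z1 z2 : (is_pole F l -> z1 = z2) ->
  component F l z z1 = component F l z z2.
Proof.
by rewrite /component; case: pickP => [i /eqP li|//] -> //; exists i.
Qed.

(** The common form of the four cases, [s] being the sign with which [x] enters
    the domain condition.  At a pole [z = 0], so the term [e * z] does not appear
    in the component. *)
Lemma component_affine F l z x e s (y : 'cV[R[i]]_(fsize F)) :
  fractions_ok F -> s * s = 1 ->
  (z *: cvec (fweight F) + cdiag (fpole F) *m y = l *: y /\
   euclid y (cvec (fweight F)) = s * (x - e * z)) <->
  y = component F l z (s * x) /\
  ((is_pole F l -> z = 0) /\
   (~ is_pole F l -> z * (e + s * fractions_sum F l) = x)).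
Proof.
move=> Fok ss; rewrite componentP //.
have xE : s * (x - e * z) = z * fractions_sum F l <->
    z * (e + s * fractions_sum F l) = x.
  split=> [h|<-].
    apply/eqP; rewrite eq_sym -subr_eq0; apply/eqP.
    have -> : x - z * (e + s * fractions_sum F l) =
      s * (s * (x - e * z) - z * fractions_sum F l) + (1 - s * s) * (x - e * z).
      by ring.
    by rewrite h ss !subrr mulr0 mul0r addr0.
  have -> : s * (z * (e + s * fractions_sum F l) - e * z) =
    s * s * (z * fractions_sum F l) by ring.
  by rewrite ss mul1r.
have cE : (is_pole F l -> z = 0) ->
    component F l z (s * (x - e * z)) = component F l z (s * x).
  by move=> z0; apply: eq_component => /z0 ->; rewrite mulr0 subr0.
split=> [[-> z0 h]|[-> [z0 h]]].
  by split; [exact: cE|split=> // /h /xE].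
by split=> //; [rewrite cE|move=> /h /xE].
Qed.

End Fractions.

(** * Square integrable functions on adjacent intervals *)
Section SquareIntegrable.
Context {R : realType}.
Implicit Types (r s t : R) (f g : R -> R[i]^o).

Lemma L2onZD s t k f g : L2on s t f -> L2on s t g -> L2on s t (k *: f + g).
Proof.
move=> /L2predP fL /L2predP gL; apply/L2predP.
by have [_] := L2pred_submod s t; apply.
Qed.

Lemma L2onZ s t k f : L2on s t f -> L2on s t (k *: f).
Proof.
move=> fL; rewrite -[k *: f]addr0; apply: L2onZD => //.
by apply/L2predP; have [] := L2pred_submod s t.
Qed.

Lemma L2classZD s t k f g : L2on s t f -> L2on s t g ->
  L2class s t (k *: f + g) = k *: L2class s t f + L2class s t g.
Proof.
move=> fL gL; have kfgL := L2onZD k fL gL.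
rewrite /L2class /GRing.scale /= L2scale_pi -L2piD; congr (\pi_(L2 s t) _)%qT.
apply: val_inj; rewrite [RHS](_ : _ =
  k *: L2val (insubd (0 : L2fun s t) f) + L2val (insubd (0 : L2fun s t) g)) //.
rewrite [LHS]insubdK; last exact/L2predP.
by rewrite [L2val _]insubdK ?[L2val (insubd _ g)]insubdK //; exact/L2predP.
Qed.

Lemma L2classZ s t k f : L2on s t f ->
  L2class s t (k *: f) = k *: L2class s t f.
Proof.
move=> fL; have L0 : L2on s t 0 by apply/L2predP; have [] := L2pred_submod s t.
have c0 : L2class s t 0 = 0.
  have := L2classZD 1 L0 L0; rewrite !scale1r addr0 => e.
  by apply: (addrI (L2class s t 0)); rewrite addr0 -e.
by rewrite -[k *: f]addr0 L2classZD // c0 addr0.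
Qed.

Lemma Lfun_indic (A : set R) : measurable A -> (lebesgue_measure A < +oo)%E ->
  (\1_A : R -> R) \in Lfun (@lebesgue_measure R) 2%:E.
Proof.
move=> mA Aoo; have mf : measurable_fun setT (\1_A : R -> R).
  exact: measurable_indic.
rewrite inE; apply/andP; split; first by rewrite inE.
rewrite inE /= /finite_norm unlock /=.
under eq_integral => x _.
  have -> : `|\1_A x : R| `^ 2 = \1_A x.
    by rewrite indicE; case: (_ \in _); rewrite ?normr1 ?normr0 ?powR1 ?powR0.
  over.
by rewrite integral_indic // setIT poweR_lty.
Qed.

(** The middle point [s] is kept as a separate term: nothing is known about the
    value of [f] there. *)
Lemma patch_split r s t (f : R -> R) : r < s -> s < t ->
  f \_ `]r, t[ = (fun x => 1 * (1 * (f \_ `]r, s[) x + 1 * (f \_ `]s, t[) x)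
                         + f s * \1_[set s] x).
Proof.
move=> rs st; apply/funext => x; rewrite !patchE indicE !mul1r.
have -> : (x \in [set s]) = (x == s) by apply/idP/eqP; rewrite in_setE.
rewrite !mem_setE !in_itv /=.
have [xs|sx|->] := ltgtP x s.
- by rewrite (lt_trans xs st) /= ?mulr0 !addr0.
- by rewrite (lt_trans rs sx) /= ?andbF mulr0 addr0 add0r.
- by rewrite rs st /= mulr1 !add0r.
Qed.

Lemma L2on_glue r s t f : r < s -> s < t ->
  L2on r s f -> L2on s t f -> L2on r t f.
Proof.
move=> rs st [fr1 fi1] [fr2 fi2].
have sL : (\1_[set s] : R -> R) \in Lfun (@lebesgue_measure R) 2%:E.
  by apply: Lfun_indic; rewrite ?lebesgue_measure_set1.
split.
  rewrite (patch_split (fun x => Re (f x)) rs st).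
  exact: Lfun2_lin (Lfun2_lin _ _ fr1 fr2) sL.
rewrite (patch_split (fun x => Im (f x)) rs st).
exact: Lfun2_lin (Lfun2_lin _ _ fi1 fi2) sL.
Qed.

Lemma ae_eq_on_glue r s t f g : r < s -> s < t ->
  ae_eq_on r t f g <-> ae_eq_on r s f g /\ ae_eq_on s t f g.
Proof.
move=> rs st; split.
  move=> fg; split; move: fg; rewrite /ae_eq_on; apply: filterS => x h xI; apply: h;
    move: xI; rewrite /= !in_itv /= => /andP[x1 x2]; apply/andP; split => //.
  - exact: lt_trans x2 st.
  - exact: lt_trans rs x1.
move=> [fg1 fg2].
have fg3 : \forall x \ae @lebesgue_measure R, x <> s.
  exists [set s]; split => //; first exact: lebesgue_measure_set1.
  by move=> x /= /contrapT.
move: fg1 fg2 fg3; rewrite /ae_eq_on; apply: filterS3 => x h1 h2 xs xI.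
move: xI; rewrite /= in_itv /= => /andP[rx xt].
have [xs'|sx|//] := ltgtP x s.
- by apply: h1; rewrite /= in_itv /= rx.
- by apply: h2; rewrite /= in_itv /= sx.
Qed.

Lemma null_set_nbhs (N : set R) (x : R) : measurable N ->
  lebesgue_measure N = 0%E -> ~ nbhs x N.
Proof.
move=> mN N0 /nbhs_ballP[e /= e0 eN].
have : (lebesgue_measure (ball x e) <= lebesgue_measure N)%E.
  apply: le_measure; rewrite ?inE //; exact: measurable_ball.
rewrite N0 lebesgue_measure_ball; last exact: ltW.
by rewrite leNgt => /negP[]; rewrite lte_fin mulrn_wgt0.
Qed.

(** The points where two continuous functions differ form an open set, and a
    nonempty open set is not null. *)
Lemma ae_eq_cont s t f g :
  (forall x, x \in `]s, t[ -> cderivable f x) ->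
  (forall x, x \in `]s, t[ -> cderivable g x) ->
  ae_eq_on s t f g -> {in `]s, t[, f =1 g}.
Proof.
move=> fd gd [N [mN N0 fgN]].
have key (u v : R -> R) (x : R) : x \in `]s, t[ -> {for x, continuous u} ->
    {for x, continuous v} ->
    (forall y, y \in `]s, t[ -> u y <> v y -> N y) ->
    u x = v x.
  move=> xI uc vc uvN; apply: contrapT => uvx.
  apply: (@null_set_nbhs _ x mN N0); near=> y; apply: uvN.
    by near: y; exact: near_in_itvoo.
  apply/eqP; rewrite -subr_eq0; near: y.
  have c : {for x, continuous (fun y => u y - v y)} by apply: continuousB.
  have z : nbhs (u x - v x) [set z : R | z != 0].
    apply: open_nbhs_nbhs; split; first exact: open_neq.
    by rewrite /= subr_eq0; apply/eqP.
  exact: c z.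
move=> x xI.
have E (z w : R[i]) : Re z = Re w -> Im z = Im w -> z = w.
  by case: z => ? ?; case: w => ? ? /= -> ->.
apply: E; [apply: (key (fun x => Re (f x)) (fun x => Re (g x))) => //
          |apply: (key (fun x => Im (f x)) (fun x => Im (g x))) => //].
- by apply: differentiable_continuous; apply/derivable1_diffP; case: (fd x xI).
- by apply: differentiable_continuous; apply/derivable1_diffP; case: (gd x xI).
- move=> y yI uv; apply: fgN => /= h; apply: uv.
  by rewrite h.
- by apply: differentiable_continuous; apply/derivable1_diffP; case: (fd x xI).
- by apply: differentiable_continuous; apply/derivable1_diffP; case: (gd x xI).
- move=> y yI uv; apply: fgN => /= h; apply: uv.
  by rewrite h.
Unshelve. all: by end_near.
Qed.

End SquareIntegrable.

(** * One-sided limits *)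
Section OneSidedLimits.
Context {R : realType}.
Implicit Types (s t x : R).

(** The case of a single subinterval. *)
Lemma abs_continuous_uniform s t (f : R -> R) e : abs_continuous s t f -> 0 < e ->
  exists2 d, 0 < d & forall u v, u \in `]s, t[ -> v \in `]s, t[ ->
    `|v - u| < d -> `|f v - f u| < e.
Proof.
move=> fac e0; have [d d0 fd] := fac e e0; exists d => // u v.
wlog uv : u v / u <= v => [H|].
  have [uv|/ltW vu] := leP u v; first exact: H.
  by move=> uI vI; rewrite distrC [`|f _ - _|]distrC; exact: H.
rewrite !in_itv /= => /andP[su ut] /andP[sv vt]; rewrite ger0_norm ?subr_ge0 // => uvd.
have := fd 1%N (fun=> u) (fun=> v); rewrite !big_ord1; apply => //.
by move=> i j _ _ _; rewrite (ord1 i) (ord1 j).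
Qed.

(** Absolute continuity on a bounded open interval gives uniform continuity, so the
    images of filters converging to an endpoint are Cauchy. *)
Lemma abs_continuous_cvg s t (f : R -> R) (F : set_system R) (x : R) :
  ProperFilter F -> F --> x -> (\forall u \near F, u \in `]s, t[) ->
  abs_continuous s t f -> cvg (f u @[u --> F]).
Proof.
move=> FF Fx FI fac; apply: cauchy_cvg; apply: cauchy_exP => e e0.
have [d d0 fd] := abs_continuous_uniform fac e0.
have Fd : \forall u \near F, `|x - u| < d / 2.
  by apply: Fx; apply: nbhsx_ballx; rewrite divr_gt0.
have [v [vI xv]] := filter_ex (filterI FI Fd).
suff : \forall u \near F, `|f v - f u| < e by exists (f v).
near=> u; apply: fd => //.
  by near: u.
rewrite (le_lt_trans (ler_distD x _ _)) // [ltRHS]splitr ltrD //.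
  by rewrite distrC.
by near: u.
Unshelve. all: by end_near.
Qed.

Lemma near_at_right_itv s t : s < t -> \forall u \near s^'+, u \in `]s, t[.
Proof.
move=> st; near=> u; rewrite in_itv /=; apply/andP; split.
  by near: u; exact: nbhs_right_gt.
by near: u; exact: nbhs_right_lt.
Unshelve. all: by end_near.
Qed.

Lemma near_at_left_itv s t : s < t -> \forall u \near t^'-, u \in `]s, t[.
Proof.
move=> st; near=> u; rewrite in_itv /=; apply/andP; split.
  by near: u; exact: nbhs_left_gt.
by near: u; exact: nbhs_left_lt.
Unshelve. all: by end_near.
Qed.

Lemma cvg_at_right s : s^'+ --> s.
Proof. exact: cvg_within. Qed.

Lemma cvg_at_left s : s^'- --> s.
Proof. exact: cvg_within. Qed.

(** Convergence and limits taken separately in the real and imaginary parts, so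
    that [rlimit] and [llimit] are instances of [clim]. *)
Definition clim (F : set_system R) (f : R -> R[i]^o) : R[i] :=
  lim (Re (f u) @[u --> F]) +i* lim (Im (f u) @[u --> F]).

Definition ccvg (F : set_system R) (f : R -> R[i]^o) : Prop :=
  cvg (Re (f u) @[u --> F]) /\ cvg (Im (f u) @[u --> F]).

Lemma ccvgZD (F : set_system R) k (f g h : R -> R[i]^o) : ProperFilter F ->
  (\forall u \near F, h u = k * f u + g u) -> ccvg F f -> ccvg F g ->
  ccvg F h /\ clim F h = k * clim F f + clim F g.
Proof.
move=> FF hE [fr fi] [gr gi].
have hr : Re (h u) @[u --> F] -->
    Re k * lim (Re (f u) @[u --> F]) - Im k * lim (Im (f u) @[u --> F])
    + lim (Re (g u) @[u --> F]).
  apply: (@cvg_trans _ ((Re k * Re (f u) - Im k * Im (f u) + Re (g u)) @[u --> F])).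
    apply: near_eq_cvg; near=> u.
    have -> : h u = k * f u + g u by near: u.
    by rewrite ReD_fun ReM_fun.
  by apply: cvgD => //; apply: cvgB; apply: cvgMr.
have hi : Im (h u) @[u --> F] -->
    Re k * lim (Im (f u) @[u --> F]) + Im k * lim (Re (f u) @[u --> F])
    + lim (Im (g u) @[u --> F]).
  apply: (@cvg_trans _ ((Re k * Im (f u) + Im k * Re (f u) + Im (g u)) @[u --> F])).
    apply: near_eq_cvg; near=> u.
    have -> : h u = k * f u + g u by near: u.
    by rewrite ImD_fun ImM_fun.
  by apply: cvgD => //; apply: cvgD; apply: cvgMr.
split; first by split; [exact: cvgP hr|exact: cvgP hi].
rewrite /clim (cvg_lim _ hr) // (cvg_lim _ hi) //.
by case: (k) => ? ?; simpc.
Unshelve. all: by end_near.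
Qed.

Lemma derive1_lincomb (a b : R) (f g h : R -> R) x :
  derivable f x 1 -> derivable g x 1 -> derivable h x 1 ->
  derivable (fun u => a * f u + b * g u + h u) x 1 /\
  derive1 (fun u => a * f u + b * g u + h u) x =
    a * derive1 f x + b * derive1 g x + derive1 h x.
Proof.
move=> df dg dh; rewrite !derive1E.
have daf : derivable (a *: f) x 1 by exact: derivableZ.
have dbg : derivable (b *: g) x 1 by exact: derivableZ.
have dab : derivable (a *: f + b *: g) x 1 by exact: derivableD.
split; first exact: (derivableD dab dh).
have e1 := deriveD dab dh; have e2 := deriveD daf dbg.
by rewrite (deriveZ a df) (deriveZ b dg) in e2; rewrite e2 in e1.
Qed.

Lemma cderiveZD k (f g : R -> R[i]^o) x : cderivable f x -> cderivable g x ->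
  cderivable (k *: f + g) x /\
  cderive (k *: f + g) x = k * cderive f x + cderive g x.
Proof.
move=> [fr fi] [gr gi].
have hr : (fun u => Re ((k *: f + g) u)) =
    (fun u => Re k * Re (f u) + - Im k * Im (f u) + Re (g u)).
  by apply/funext => u; rewrite mulNr -ReM_fun -ReD_fun.
have hi : (fun u => Im ((k *: f + g) u)) =
    (fun u => Re k * Im (f u) + Im k * Re (f u) + Im (g u)).
  by apply/funext => u; rewrite -ImM_fun -ImD_fun.
have [drd drE] := derive1_lincomb (Re k) (- Im k) fr fi gr.
have [did diE] := derive1_lincomb (Re k) (Im k) fi fr gi.
rewrite /cderivable /cderive hr hi drE diE; split=> //.
by case: k {hr hi drd drE did diE} => kr ki; simpc.
Qed.

Lemma cderive0 : cderive (0 : R -> R[i]^o) = 0.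
Proof.
by apply/funext => x; rewrite /cderive !derive1_cst.
Qed.

Lemma ccvg0 (F : set_system R) : ProperFilter F -> ccvg F (0 : R -> R[i]^o).
Proof. by move=> FF; split; exact: is_cvg_cst. Qed.

Lemma cderivable0 x : cderivable (0 : R -> R[i]^o) x.
Proof. by split; exact: derivable_cst. Qed.

End OneSidedLimits.

(** * Transfer of dimension along a linear injection *)
(** Either side of the equivalence makes one of [S] and [Phi @` S] a span; linear
    combinations taken in the subspace [T] then stay in the other one as well,
    because [Phi] is injective on all of [T]. *)
Lemma has_dim_image (K : fieldType) (V W : lmodType K) (T S : set V)
    (Phi : V -> W) n :
  T 0 -> (forall k u v, T u -> T v -> T (k *: u + v)) ->
  (forall k u v, T u -> T v -> Phi (k *: u + v) = k *: Phi u + Phi v) ->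
  (forall u v, T u -> T v -> Phi u = Phi v -> u = v) ->
  S `<=` T -> has_dim (Phi @` S) n <-> has_dim S n.
Proof.
move=> T0 TZD PhiZD PhiI ST.
have Phi0 : Phi 0 = 0.
  have := PhiZD 1 0 0 T0 T0; rewrite !scale1r addr0 => e.
  by apply: (addrI (Phi 0)); rewrite addr0 -e.
have sumT (v : 'I_n -> V) (k : 'I_n -> K) : (forall i, T (v i)) ->
    T (\sum_i k i *: v i) /\ Phi (\sum_i k i *: v i) = \sum_i k i *: Phi (v i).
  move=> Tv; elim/big_rec2: _ => [//|i x y _ [Ty <-]].
  by split; [exact: TZD|rewrite PhiZD].
have spanS (U : lmodType K) (e : 'I_n -> U) i :
    [set \sum_j k j *: e j | k in [set: 'I_n -> K]] (e i).
  exists (fun j => (j == i)%:R) => //=.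
  rewrite (bigD1 i) //= eqxx scale1r big1 ?addr0 // => j /negPf ->.
  by rewrite scale0r.
split=> -[e [indep SE]].
  have /choice[v vE] : forall i, exists u, S u /\ Phi u = e i.
    by move=> i; have := spanS _ e i; rewrite -SE => -[u Su <-]; exists u.
  have Tv i : T (v i) by apply: ST; have [] := vE i.
  have sumE k : Phi (\sum_i k i *: v i) = \sum_i k i *: e i.
    rewrite (sumT v k Tv).2; apply: eq_bigr => i _.
    by have [_ ->] := vE i.
  exists v; split=> [k k0|].
    by apply: indep; rewrite -sumE k0 Phi0.
  apply/seteqP; split=> [u Su|_ [k _ <-]].
    have : (Phi @` S) (Phi u) by exists u.
    rewrite SE => -[k _ kE]; exists k => //; apply: PhiI.
    - exact: (sumT v k Tv).1.
    - exact: ST.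
    - by rewrite sumE.
  have : (Phi @` S) (\sum_i k i *: e i) by rewrite SE; exists k.
  move=> [w Sw]; rewrite -sumE => wE; rewrite -(PhiI w _ _ _ wE) //.
    exact: ST.
  exact: (sumT v k Tv).1.
have Se i : S (e i) by rewrite SE; exact: spanS.
have Te i : T (e i) by exact: ST.
exists (fun i => Phi (e i)); split=> [k k0|].
  apply: indep; apply: PhiI => //; first exact: (sumT e k Te).1.
  by rewrite (sumT e k Te).2 k0.
apply/seteqP; split=> [_ [u Su <-]|_ [k _ <-]].
  by move: Su; rewrite SE => -[k _ <-]; exists k => //; rewrite (sumT e k Te).2.
by exists (\sum_i k i *: e i); [rewrite SE; exists k|exact: (sumT e k Te).2].
Qed.

Lemma subr_eq0_iff (K : zmodType) (x w : K) : x - w = 0 <-> w = x.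
Proof. by split=> [/subr0_eq|->]; rewrite ?subrr. Qed.

(** * Solutions of the boundary value problem and eigenvectors of the operator *)
Section Equivalence.
Context {R : realType} (D : sl_data R) (hD : sl_admissible D) (lambda : R[i]).
Implicit Types (y z : R -> R[i]^o).

Local Notation a := (sl_a D).
Local Notation b := (sl_b D).
Local Notation ell := (sturm_liouville (sl_q D)).

Let Na0 : - a < 0. Proof. by rewrite oppr_lt0 (sl_a_gt0 hD). Qed.
Let b0 : 0 < b. Proof. exact: sl_b_gt0 hD. Qed.

(** A space that contains the regular functions and is closed under linear
    combinations for elementary reasons.  For the regular functions themselves
    closure would require that their second derivatives exist almost everywhere,
    which is Lebesgue's theorem on absolutely continuous functions. *)
Definition tame y : Prop :=
  [/\ on_domain D y, L2on (- a) b y,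
      (forall x, x \in `](- a), 0[ -> cderivable y x),
      (forall x, x \in `]0, b[ -> cderivable y x) &
      [/\ ccvg 0^'+ y, ccvg 0^'- y,
          ccvg 0^'+ (cderive y) & ccvg 0^'- (cderive y)]].

Lemma piecewise_regular_tame y : piecewise_regular D y -> tame y.
Proof.
move=> [yD [d1 [ar1 ai1] [dar1 dai1] [l1 _ _]] [d2 [ar2 ai2] [dar2 dai2] [l2 _ _]]].
split=> //; first exact: L2on_glue l1 l2.
have cr (f : R -> R) : abs_continuous 0 b f -> cvg (f u @[u --> 0^'+]).
  exact: abs_continuous_cvg (@cvg_at_right R 0) (near_at_right_itv b0).
have cl (f : R -> R) : abs_continuous (- a) 0 f -> cvg (f u @[u --> 0^'-]).
  exact: abs_continuous_cvg (@cvg_at_left R 0) (near_at_left_itv Na0).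
by split; split; [exact: cr|exact: cr|exact: cl|exact: cl
                 |exact: cr|exact: cr|exact: cl|exact: cl].
Qed.

Lemma tame0 : tame 0.
Proof.
split=> //; try by move=> *; exact: cderivable0.
  by apply/L2predP; have [] := L2pred_submod (- a) b.
by rewrite cderive0; split; exact: ccvg0.
Qed.

Lemma tameZD k y z : tame y -> tame z ->
  [/\ tame (k *: y + z),
      rlimit (k *: y + z) 0 = k * rlimit y 0 + rlimit z 0,
      llimit (k *: y + z) 0 = k * llimit y 0 + llimit z 0,
      rlimit (cderive (k *: y + z)) 0
        = k * rlimit (cderive y) 0 + rlimit (cderive z) 0 &
      llimit (cderive (k *: y + z)) 0
        = k * llimit (cderive y) 0 + llimit (cderive z) 0].
Proof.
move=> [yD yL y1 y2 [ry ly rdy ldy]] [zD zL z1 z2 [rz lz rdz ldz]].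
have nr : \forall u \near 0^'+, (k *: y + z) u = k * y u + z u by apply: nearW.
have nl : \forall u \near 0^'-, (k *: y + z) u = k * y u + z u by apply: nearW.
have ndr : \forall u \near 0^'+,
    cderive (k *: y + z) u = k * cderive y u + cderive z u.
  near=> u; have uI : u \in `]0, b[ by near: u; exact: near_at_right_itv.
  by have [] := cderiveZD k (y2 u uI) (z2 u uI).
have ndl : \forall u \near 0^'-,
    cderive (k *: y + z) u = k * cderive y u + cderive z u.
  near=> u; have uI : u \in `](- a), 0[ by near: u; exact: near_at_left_itv.
  by have [] := cderiveZD k (y1 u uI) (z1 u uI).
have [cr er] := ccvgZD _ nr ry rz; have [cl el] := ccvgZD _ nl ly lz.
have [cdr edr] := ccvgZD _ ndr rdy rdz; have [cdl edl] := ccvgZD _ ndl ldy ldz.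
split; [split|exact: er|exact: el|exact: edr|exact: edl].
- move=> x x1 x2; rewrite [LHS](_ : _ = k * y x + z x) // yD // zD //.
  by rewrite mulr0 addr0.
- exact: L2onZD.
- by move=> x xI; have [] := cderiveZD k (y1 x xI) (z1 x xI).
- by move=> x xI; have [] := cderiveZD k (y2 x xI) (z2 x xI).
- by [].
Unshelve. all: by end_near.
Qed.

Lemma tame_class_inj y z : tame y -> tame z ->
  L2class (- a) b y = L2class (- a) b z -> y = z.
Proof.
move=> [yD yL y1 y2 _] [zD zL z1 z2 _] /(L2classP yL zL).
move=> /(ae_eq_on_glue _ _ Na0 b0)[e1 e2]; apply/funext => x.
have [x1|x1] := boolP (x \in `](- a), 0[); first exact: (ae_eq_cont y1 z1 e1).
have [x2|x2] := boolP (x \in `]0, b[); first exact: (ae_eq_cont y2 z2 e2).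
by rewrite yD // zD.
Qed.

Lemma representativeE y : piecewise_regular D y ->
  @representative R D (L2class (- a) b y) = y.
Proof.
move=> yr; apply: xget_unique => [|z [zr zy]]; first by split.
by apply: tame_class_inj zy; exact: piecewise_regular_tame.
Qed.

(** The point 0, where [ell y] has no meaning, is a null set. *)
Lemma class_equation y : piecewise_regular D y ->
  L2class (- a) b (ell y) = lambda *: L2class (- a) b y <->
  ae_eq_on (- a) 0 (ell y) (lambda *: y) /\ ae_eq_on 0 b (ell y) (lambda *: y).
Proof.
move=> yr; have [_ yL _ _ _] := piecewise_regular_tame yr.
have [_ [_ _ _ [_ _ l1]] [_ _ _ [_ _ l2]]] := yr.
rewrite -L2classZ // -ae_eq_on_glue //; apply: L2classP; last exact: L2onZ.
exact: L2on_glue l1 l2.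
Qed.

Lemma component1P y (y1 : 'cV[R[i]]_(fsize (fractions1 D))) :
  (if 0 < sl_eta D then jump' y else rlimit y 0) *: cvec (fweight (fractions1 D))
    + cdiag (fpole (fractions1 D)) *m y1 = lambda *: y1 /\
  (if 0 < sl_eta D
   then - rlimit y 0 + (sl_sigma D)%:C * jump' y
          - euclid y1 (cvec (fweight (fractions1 D))) = 0
   else jump' y - (sl_xi D)%:C * rlimit y 0
          - euclid y1 (cvec (fweight (fractions1 D))) = 0) <->
  y1 = component1 D lambda y /\ transmission_mu D lambda y.
Proof.
move: y1; rewrite /component1 /fractions1 /transmission_mu.
have Fok := sl_bc_ok hD; have mu := sl_inv_mu hD.
move: (rlimit y 0) (jump' y) => u v.
have muE l : sl_mu D l =
    (sl_xi D)%:C + - (sl_eta D)%:C * l + 1 * fractions_sum (sl_bc D) l.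
  by rewrite /sl_mu; ring.
case: ifP => h y1.
  have {mu}[_ Gok mu] := mu h.
  have eta_neq0 : - (sl_eta D)%:C != 0 :> R[i].
    by rewrite oppr_eq0 (fmorph_eq0 (real_complex R)) gt_eqF.
  have N1 : -1 != 0 :> R[i] by rewrite oppr_eq0 oner_neq0.
  have [] := fractions_reciprocal (c := (sl_xi D)%:C) (e := (sl_sigma D)%:C)
    Fok Gok eta_neq0 (oner_neq0 _) N1 _ lambda.
    by move=> l; rewrite -muE mulN1r; exact: mu.
  rewrite -muE => mr1 Fr Gm.
  have T := transmission_reciprocal u v mr1 Fr Gm.
  have NN : -1 * -1 = 1 :> R[i] by rewrite mulrNN mulr1.
  have C := component_affine lambda v u (sl_sigma D)%:C y1 Gok NN.
  rewrite (mulN1r u) in C.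
  apply: (iff_trans _ (iff_trans C (and_iff_compat_l _ (iff_sym T)))).
  apply: and_iff_compat_l; rewrite subr_eq0_iff.
  by have -> : - u + (sl_sigma D)%:C * v = -1 * (u - (sl_sigma D)%:C * v) by ring.
have eta0 : sl_eta D = 0.
  by apply/eqP; rewrite eq_le (sl_eta_ge0 hD) leNgt h.
have C := component_affine lambda u v (sl_xi D)%:C y1 Fok (mulr1 1).
rewrite (mul1r v) (mul1r (v - _)) in C.
rewrite muE eta0 (rmorph0 (real_complex R)) oppr0 mul0r addr0.
by apply: (iff_trans _ C); apply: and_iff_compat_l; rewrite subr_eq0_iff.
Qed.

Lemma component2P y (y2 : 'cV[R[i]]_(fsize (fractions2 D))) :
  (if 0 < sl_kappa D then jump y else llimit (cderive y) 0)
      *: cvec (fweight (fractions2 D))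
    + cdiag (fpole (fractions2 D)) *m y2 = lambda *: y2 /\
  (if 0 < sl_kappa D
   then llimit (cderive y) 0 - (sl_tau D)%:C * jump y
          - euclid y2 (cvec (fweight (fractions2 D))) = 0
   else - jump y + (sl_zeta D)%:C * llimit (cderive y) 0
          - euclid y2 (cvec (fweight (fractions2 D))) = 0) <->
  y2 = component2 D lambda y /\ transmission_nu D lambda y.
Proof.
move: y2; rewrite /component2 /fractions2 /transmission_nu.
have Fok := sl_ad_ok hD; have nu := sl_inv_nu hD.
move: (llimit (cderive y) 0) (jump y) => u v.
have nuE l : sl_nu D l =
    (sl_zeta D)%:C + (sl_kappa D)%:C * l + -1 * fractions_sum (sl_ad D) l.
  by rewrite /sl_nu; ring.
have N1 : -1 != 0 :> R[i] by rewrite oppr_eq0 oner_neq0.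
case: ifP => h y2.
  have {nu}[_ Gok nu] := nu h.
  have kappa_neq0 : (sl_kappa D)%:C != 0 :> R[i].
    by rewrite (fmorph_eq0 (real_complex R)) gt_eqF.
  have [] := fractions_reciprocal (c := (sl_zeta D)%:C) (e := (sl_tau D)%:C)
    Fok Gok kappa_neq0 N1 (oner_neq0 _) _ lambda.
    by move=> l; rewrite -nuE mul1r; exact: nu.
  rewrite -nuE => mr1 Fr Gm.
  have T := transmission_reciprocal u v mr1 Fr Gm.
  have C := component_affine lambda v u (sl_tau D)%:C y2 Gok (mulr1 1).
  rewrite (mul1r u) (mul1r (u - _)) in C.
  apply: (iff_trans _ (iff_trans C (and_iff_compat_l _ (iff_sym T)))).
  by apply: and_iff_compat_l; rewrite subr_eq0_iff.
have kappa0 : sl_kappa D = 0.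
  by apply/eqP; rewrite eq_le (sl_kappa_ge0 hD) leNgt h.
have NN : -1 * -1 = 1 :> R[i] by rewrite mulrNN mulr1.
have C := component_affine lambda u v (sl_zeta D)%:C y2 Fok NN.
rewrite (mulN1r v) in C; rewrite nuE kappa0 (rmorph0 (real_complex R)) mul0r addr0.
apply: (iff_trans _ C); apply: and_iff_compat_l; rewrite subr_eq0_iff.
by have -> : - v + (sl_zeta D)%:C * u = -1 * (v - (sl_zeta D)%:C * u) by ring.
Qed.

Definition eigenvector_of y : spaceH D :=
  (L2class (- a) b y, component1 D lambda y, component2 D lambda y).

Lemma eigenvector_ofZD k y z : tame y -> tame z ->
  eigenvector_of (k *: y + z) = k *: eigenvector_of y + eigenvector_of z.
Proof.
move=> yT zT; have [_ er el edr edl] := tameZD k yT zT.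
have [_ yL _ _ _] := yT; have [_ zL _ _ _] := zT.
have eL := L2classZD k yL zL.
move: er el edr edl eL; move: (k *: y + z) => w er el edr edl eL.
have NE (p q : R[i]) : - (k * p + q) = k * - p + - q by ring.
have BE (p q p' q' : R[i]) : k * p + q - (k * p' + q') = k * (p - p') + (q - q').
  by ring.
have jE : jump w = k * jump y + jump z by rewrite /jump er el BE.
have jE' : jump' w = k * jump' y + jump' z by rewrite /jump' edr edl BE.
have c1 : component1 D lambda w = k *: component1 D lambda y + component1 D lambda z.
  rewrite /component1 jE' er; move: (rlimit y 0) (rlimit z 0) (jump' y) (jump' z).
  by move=> p q p' q'; case: ifP => _; rewrite ?NE componentD.
have c2 : component2 D lambda w = k *: component2 D lambda y + component2 D lambda z.
  rewrite /component2 jE edl.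
  move: (llimit (cderive y) 0) (llimit (cderive z) 0) (jump y) (jump z).
  by move=> p q p' q'; case: ifP => _; rewrite ?NE componentD.
by rewrite /eigenvector_of c1 c2 eL.
Qed.

Lemma eigenvector_of_inj y z : tame y -> tame z ->
  eigenvector_of y = eigenvector_of z -> y = z.
Proof.
move=> yT zT e; have e1 : L2class (- a) b y = L2class (- a) b z.
  by have := f_equal (fun Y : spaceH D => Y.1.1) e.
exact: tame_class_inj yT zT e1.
Qed.

Lemma eigenvector_of0 : eigenvector_of 0 = 0.
Proof.
have := eigenvector_ofZD 1 tame0 tame0; rewrite !scale1r addr0 => e.
by apply: (addrI (eigenvector_of 0)); rewrite addr0 -e.
Qed.

Lemma solutionsP_tame y : solutionsP D lambda y -> tame y.
Proof. by case=> yr _ _ _ _; exact: piecewise_regular_tame. Qed.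

Lemma eigenspaceLE : eigenspaceL D lambda = eigenvector_of @` solutionsP D lambda.
Proof.
apply/seteqP; split=> [[[u y1] y2]|_ [y [yr e bc t1 t2] <-]].
  move=> [/= [[yr yu] bc d1 d2] [e0 e1 e2]].
  set y := representative u in yr yu bc d1 d2 e0 e1 e2.
  have [y1E t1] := (component1P y y1).1 (conj e1 d1).
  have [y2E t2] := (component2P y y2).1 (conj e2 d2).
  exists y; last by rewrite /eigenvector_of yu -y1E -y2E.
  by split=> //; apply/(class_equation yr); rewrite yu.
have [e1 d1] := (component1P y _).2 (conj erefl t1).
have [e2 d2] := (component2P y _).2 (conj erefl t2).
have yE := representativeE yr.
split; first by rewrite /domainL /= yE.
rewrite /opL /= yE e1 e2.
by have -> := (class_equation yr).2 e.
Qed.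

End Equivalence.

Theorem theorem4p1 (R : realType) (D : sl_data R) (hD : sl_admissible D)
    (lambda : R[i]) :
  (forall Y : spaceH D,
     eigenvectorL D lambda Y <->
     exists2 y, eigenfunctionP D lambda y &
       Y = (L2class (- sl_a D)%R (sl_b D) y,
            component1 D lambda y, component2 D lambda y))
  /\
  (forall n : nat,
     has_dim (eigenspaceL D lambda) n <-> has_dim (solutionsP D lambda) n).
Proof.
split=> [Y|n]; last first.
  rewrite (eigenspaceLE hD); apply: has_dim_image.
  - exact: (tame0 D).
  - by move=> k u v uT vT; have [] := tameZD hD k uT vT.
  - by move=> k u v; exact: eigenvector_ofZD.
  - by move=> u v; exact: eigenvector_of_inj.
  - by move=> y; exact: solutionsP_tame.
rewrite /eigenvectorL (eigenspaceLE hD); split.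
  move=> [[y yS <-] y0]; exists y => //; split=> // y_0.
  by apply: y0; rewrite y_0 eigenvector_of0.
move=> [y [yS y0] YE]; have {}YE : Y = eigenvector_of D lambda y by [].
rewrite YE; split; first by exists y.
rewrite -(eigenvector_of0 hD lambda) => /(eigenvector_of_inj hD) e.
by apply: y0; apply: e; [exact: solutionsP_tame yS|exact: tame0].
Qed.
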